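(* Let $\mathbf A\in\mathfrak R^{N\times N}$, $\mathbf B\in\mathfrak R^{N\times q}$, $\mathbf C\in\mathfrak R^{p\times N}$, $\mathbf D\in\mathfrak R^{p\times q}$. Assume that the realization \[ \mathscr H(\zeta,0)=\mathbf D(0)+\zeta\,\mathbf C(0)(I_N-\zeta\mathbf A(0))^{-1}\mathbf B(0) \] is observable, i.e. the pair of complex matrices $(\mathbf C(0),\mathbf A(0))$ is observable over $\mathbb C$. Then the realization \[ \mathscr H(\zeta)=\mathbf D+\zeta\,\mathbf C(I_N-\zeta\mathbf A)^{-1}\mathbf B \] is observable, i.e. the pair $(\mathbf C,\mathbf A)$ is observable over $\mathfrak R$.
   Context: Let $\ell$ be the set of sequences $\alpha=(\alpha_1,\alpha_2,\ldots)$ with entries in $\{0,1,2,\ldots\}$ and only finitely many non-zero entries. For $\alpha\in\ell$ put $z^\alpha=z_1^{\alpha_1}z_2^{\alpha_2}\cdots$ (countably many complex variables $z=(z_1,z_2,\ldots)$) and $(2\mathbb N)^{c\alpha}=\prod_{j\ge1}(2j)^{c\alpha_j}$ for $c\in\mathbb Z$. The ring $\mathfrak R$ is the image of the Kondratiev space $S_{-1}$ under the Hermite transform, i.e. the set of power series $\sum_{\alpha\in\ell}f_\alpha z^\alpha$, $f_\alpha\in\mathbb C$, such that $\sum_{\alpha\in\ell}|f_\alpha|^2(2\mathbb N)^{-k\alpha}<\infty$ for some $k\in\{1,2,\ldots\}$; it is a commutative ring (an integral domain containing $\mathbb C$ as the constant series) under the usual addition and multiplication of power series. The constant coefficient of $\mathbf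 F\in\mathfrak R$ is denoted $\mathbf F(0)$ (entrywise for matrices). For a commutative ring $R$ (here $R=\mathfrak R$ or $R=\mathbb C$), a pair $(C,A)\in R^{p\times N}\times R^{N\times N}$ is called observable if the map $f\mapsto(Cf,\ CAf,\ CA^2f,\ \ldots)$ from $R^N$ into $(R^p)^{\mathbb N}$ is injective. A realization $D+\zeta C(I_N-\zeta A)^{-1}B$ is called observable if the pair $(C,A)$ is observable. (For $\zeta\in\mathbb C$ with $\det(I_N-\zeta\mathbf A(0))\ne0$ the matrix $I_N-\zeta\mathbf A$ is invertible in $\mathfrak R^{N\times N}$.) *)

(* Defs.v *)
From HB Require Import structures.
From mathcomp Require Import all_boot all_order all_algebra finmap complex.
From mathcomp Require Import mathcomp_extra boolp classical_sets cardinality.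
From mathcomp Require Import functions fsbigop reals ereal esum lra.

Set Implicit Arguments.
Unset Strict Implicit.
Unset Printing Implicit Defensive.

Import Order.TTheory GRing.Theory Num.Theory.

Local Open Scope classical_set_scope.
Local Open Scope fset_scope.
Local Open Scope complex_scope.
Local Open Scope ring_scope.

(* Indexing starts at 0: the entry [a j] of a multi-index is the exponent of
   the variable z_(j+1). *)
Definition mindex := {fsfun nat -> nat with 0%N}.

HB.instance Definition _ := Choice.on mindex.

Definition mindex_zero : mindex := [fsfun].
Definition mindex_add (a b : mindex) : mindex :=
  [fsfun j in finsupp a `|` finsupp b => (a j + b j)%N].

Lemma mindexP (a b : mindex) : a =1 b -> a = b.
Proof. by move=> ab; apply/fsfunP. Qed.

Lemma mindex_zeroE j : mindex_zero j = 0%N.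
Proof. by rewrite fsfunE. Qed.

Lemma mindex_addE a b j : mindex_add a b j = (a j + b j)%N.
Proof.
rewrite fsfunE; case: ifPn => //.
by rewrite in_fsetU negb_or => /andP[ja jb]; rewrite !fsfun_dflt.
Qed.

Lemma mindex_addA : associative mindex_add.
Proof. by move=> a b c; apply: mindexP => j; rewrite !mindex_addE addnA. Qed.

Lemma mindex_addC : commutative mindex_add.
Proof. by move=> a b; apply: mindexP => j; rewrite !mindex_addE addnC. Qed.

Lemma mindex_add0 : left_id mindex_zero mindex_add.
Proof. by move=> a; apply: mindexP => j; rewrite !mindex_addE mindex_zeroE. Qed.

HB.instance Definition _ :=
  GRing.isNmodule.Build mindex mindex_addA mindex_addC mindex_add0.

Lemma mindexD (a b : mindex) j : (a + b) j = (a j + b j)%N.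
Proof. exact: mindex_addE. Qed.

Lemma mindex0 j : (0 : mindex) j = 0%N.
Proof. exact: mindex_zeroE. Qed.

Lemma mindex_addI (a b c : mindex) : a + b = a + c -> b = c.
Proof.
move=> /fsfunP abc; apply: mindexP => j.
by have := abc j; rewrite !mindexD => /addnI.
Qed.

Lemma mindex_add_eq0 (a b : mindex) : a + b = 0 -> a = 0 /\ b = 0.
Proof.
move=> /fsfunP ab; split; apply: mindexP => j; have := ab j;
  by rewrite mindexD mindex0 => /eqP; rewrite addn_eq0 => /andP[/eqP ? /eqP ?].
Qed.

Definition splits (a : mindex) : set (mindex * mindex) :=
  [set p | p.1 + p.2 = a].

Definition mindex_sub (a b : mindex) : mindex :=
  [fsfun j in finsupp a => (a j - b j)%N].

Definition box (a : mindex) : seq mindex :=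
  [seq [fsfun j : finsupp a => nat_of_ord (f j)] |
     f : {dffun forall j : finsupp a, 'I_(a (val j)).+1}].

Lemma size_box a : size (box a) = (\prod_(j <- finsupp a) (a j).+1)%N.
Proof.
rewrite size_image card_dep_ffun big_seq_fsetE /= /index_enum -enumT /=.
rewrite /image_mem; elim: (enum _) => [|j s IHs] /=; first by rewrite big_nil.
by rewrite big_cons card_ord IHs.
Qed.

Lemma box_mem (a b : mindex) : (forall j, (b j <= a j)%N) -> b \in box a.
Proof.
move=> ba; pose F : {dffun forall j : finsupp a, 'I_(a (val j)).+1} :=
  [ffun j => inord (b (val j))].
have -> : b = [fsfun j : finsupp a => nat_of_ord (F j)]; last first.
  by rewrite /box /image_mem; apply: map_f; rewrite mem_enum.
apply: mindexP => j; rewrite fsfun_ffun; case: insubP => [u _ <-|] /=.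
  by rewrite ffunE inordK// ltnS.
move=> /fsfun_dflt aj; move: (ba j); rewrite aj; by rewrite leqn0 => /eqP.
Qed.

Definition split_seq (a : mindex) : seq (mindex * mindex) :=
  undup [seq p <- [seq (b, mindex_sub a b) | b <- box a] | p.1 + p.2 == a].

Lemma split_seq_uniq a : uniq (split_seq a).
Proof. exact: undup_uniq. Qed.

Lemma split_seqP a p : (p \in split_seq a) = (p.1 + p.2 == a).
Proof.
rewrite mem_undup mem_filter andb_idr// => /eqP pa.
have pj j : a j = (p.1 j + p.2 j)%N by rewrite -pa mindexD.
apply/mapP; exists p.1; first by apply: box_mem => j; rewrite pj leq_addr.
case: p pa pj => b c /= _ pj; congr pair; apply: mindexP => j.
rewrite fsfunE; case: ifPn => [_|/fsfun_dflt]; first by rewrite pj addKn.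
by rewrite pj => /eqP; rewrite addn_eq0 => /andP[_ /eqP].
Qed.

Lemma split_seq_size a :
  (size (split_seq a) <= \prod_(j <- finsupp a) (a j).+1)%N.
Proof.
rewrite -size_box -(size_map (fun b => (b, mindex_sub a b)) (box a)).
by rewrite (leq_trans (size_undup _))// size_filter count_size.
Qed.

Lemma fsbig_splits (V : nmodType) a (F : mindex * mindex -> V) :
  \sum_(p \in splits a) F p = \sum_(p <- split_seq a) F p.
Proof.
rewrite (fsbig_seq _ _ (split_seq_uniq a)); apply: eq_fsbigl.
by apply/seteqP; split => p /=; rewrite split_seqP => /eqP.
Qed.

Section Kondratiev.
Context {R : realType}.
Implicit Types (a : mindex) (f g h : mindex -> R[i]).

(* (2N)^(c a) *)
Definition weight (c : int) a : R :=
  \prod_(j <- finsupp a) (2 * j.+1)%:R ^ (c * (a j)%:Z).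

Definition in_kondratiev f : Prop :=
  exists k : nat, (0 < k)%N /\
    (\esum_(a in [set: mindex])
       (Normc.normc (f a) ^+ 2 * weight (- k%:Z) a)%:E < +oo)%E.

Definition cauchy_prod f g : mindex -> R[i] :=
  fun a => \sum_(p \in splits a) f p.1 * g p.2.

Definition const_series (c : R[i]) : mindex -> R[i] :=
  fun a => if a == 0 then c else 0.

Lemma cauchy_prodE f g a :
  cauchy_prod f g a = \sum_(p <- split_seq a) f p.1 * g p.2.
Proof. exact: fsbig_splits. Qed.

Lemma cauchy_prodC f g : cauchy_prod f g = cauchy_prod g f.
Proof.
apply/funext => a; rewrite !cauchy_prodE.
pose sw (p : mindex * mindex) := (p.2, p.1).
have swI : injective sw by move=> [? ?] [? ?] [-> ->].
rewrite (perm_big (map sw (split_seq a))) /=; last first.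
  apply: uniq_perm; rewrite ?map_inj_uniq ?split_seq_uniq// => p.
  apply/idP/mapP => [|[q]]; rewrite split_seqP => pa.
    by exists (sw p); [rewrite split_seqP addrC | case: p {pa}].
  by move=> ->; rewrite split_seqP addrC.
by rewrite big_map; apply: eq_bigr => p _; rewrite mulrC.
Qed.

Lemma cauchy_prodA f g h :
  cauchy_prod f (cauchy_prod g h) = cauchy_prod (cauchy_prod f g) h.
Proof.
apply/funext => a; rewrite !cauchy_prodE.
under eq_bigr => p _ do rewrite cauchy_prodE mulr_sumr.
under [RHS]eq_bigr => p _ do rewrite cauchy_prodE mulr_suml.
pose F (t : mindex * mindex * mindex) := f t.1.1 * g t.1.2 * h t.2.
pose s1 := [seq ((p.1, q.1), q.2) | p <- split_seq a, q <- split_seq p.2].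
pose s2 := [seq (q, p.2) | p <- split_seq a, q <- split_seq p.1].
transitivity (\sum_(t <- s1) F t).
  rewrite big_allpairs_dep; apply: eq_bigr => p _; apply: eq_bigr => q _.
  by rewrite mulrA.
transitivity (\sum_(t <- s2) F t); last by rewrite big_allpairs_dep.
apply: perm_big; apply: uniq_perm.
- apply: allpairs_uniq_dep; first exact: split_seq_uniq.
    by move=> p _; exact: split_seq_uniq.
  move=> x y /allpairsPdep[[p1 p2] [[q1 q2] [_ + ->]]].
  rewrite split_seqP /= => /eqP <-.
  move=> /allpairsPdep[[p1' p2'] [[q1' q2'] [_ + ->]]] /=.
  by rewrite split_seqP /= => /eqP <- [-> -> ->].
- apply: allpairs_uniq_dep; first exact: split_seq_uniq.
    by move=> p _; exact: split_seq_uniq.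
  move=> x y /allpairsPdep[[p1 p2] [[q1 q2] [_ + ->]]].
  rewrite split_seqP /= => /eqP <-.
  move=> /allpairsPdep[[p1' p2'] [[q1' q2'] [_ + ->]]] /=.
  by rewrite split_seqP /= => /eqP <- [-> -> ->].
move=> [[x y] z]; apply/allpairsPdep/allpairsPdep.
  move=> [[p1 p2] [[q1 q2] []]]; rewrite !split_seqP /=.
  move=> /eqP <- /eqP <- [-> -> ->].
  by exists (p1 + q1, q2), (p1, q1); rewrite !split_seqP /= addrA.
move=> [[p1 p2] [[q1 q2] []]]; rewrite !split_seqP /=.
move=> /eqP <- /eqP <- [-> -> ->].
by exists (q1, q2 + p2), (q2, p2); rewrite !split_seqP /= addrA.
Qed.

Lemma cauchy_prod1 f : cauchy_prod (const_series 1) f = f.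
Proof.
apply/funext => a; rewrite cauchy_prodE.
rewrite (bigD1_seq (0, a)) ?split_seq_uniq ?split_seqP /= ?add0r//.
rewrite /const_series eqxx mul1r big_seq_cond big1 ?addr0// => -[b c] /=.
rewrite split_seqP /= => /andP[/eqP bca]; rewrite -bca.
by have [->|_] := eqVneq b 0; rewrite ?add0r ?eqxx// mul0r.
Qed.

Lemma cauchy_prodDl f f' g :
  cauchy_prod (f + f') g = cauchy_prod f g + cauchy_prod f' g.
Proof.
apply/funext => a; rewrite [RHS](_ : _ = cauchy_prod f g a + cauchy_prod f' g a)//.
rewrite !cauchy_prodE -big_split /=.
by apply: eq_bigr => p _; rewrite -mulrDl.
Qed.


Definition nweight a : R := \prod_(j <- finsupp a) (2 * j.+1)%:R ^+ a j.

Lemma weightN (k : nat) a : weight (- k%:Z) a = nweight a ^- k.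
Proof.
rewrite /weight /nweight -prodrXl -prodfV; apply: eq_bigr => j _.
by rewrite mulNr -PoszM -exprnN -exprM [(k * _)%N]mulnC.
Qed.

Lemma nweightE (A : {fset nat}) a : finsupp a `<=` A ->
  nweight a = \prod_(j <- A) (2 * j.+1)%:R ^+ a j.
Proof.
move=> aA; rewrite /nweight; apply: big_fset_incl => // j _ /fsfun_dflt ->.
by rewrite expr0.
Qed.

Lemma nweightD a b : nweight (a + b) = nweight a * nweight b.
Proof.
pose A := finsupp a `|` finsupp b.
rewrite (@nweightE A a) ?fsubsetUl// (@nweightE A b) ?fsubsetUr//.
rewrite (@nweightE A (a + b)) ?finsupp_sub// -big_split.
by apply: eq_bigr => j _; rewrite mindexD exprD.
Qed.

Lemma nweight_ge1 a : 1 <= nweight a.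
Proof.
apply: (big_ind (fun x => 1 <= x)) => [//|x y x1 y1|j _]; first by rewrite mulr_ege1.
by rewrite exprn_ege1// ler1n.
Qed.

Lemma nweight_gt0 a : 0 < nweight a.
Proof. exact: lt_le_trans ltr01 (nweight_ge1 a). Qed.

Lemma size_splits_le a : (size (split_seq a))%:R <= nweight a.
Proof.
apply: (@le_trans _ _ ((\prod_(j <- finsupp a) (a j).+1)%N)%:R).
  by rewrite ler_nat split_seq_size.
rewrite natr_prod; apply: ler_prod => j _; rewrite ler0n /= -natrX ler_nat.
rewrite expnMn (leq_trans (ltn_expl _ (ltnSn 1)))// leq_pmulr// expn_gt0//.
Qed.

Lemma sqr_sum_le (I : Type) (s : seq I) (x : I -> R) :
  (\sum_(i <- s) x i) ^+ 2 <= (size s)%:R * \sum_(i <- s) x i ^+ 2.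
Proof.
elim: s => [|i s IHs] /=; first by rewrite !big_nil expr0n mul0r.
rewrite !big_cons; set S := \sum_(j <- s) x j in IHs *.
set Q := \sum_(j <- s) x j ^+ 2 in IHs *.
have Q0 : 0 <= Q by apply: sumr_ge0 => j _; exact: sqr_ge0.
have : 2 * (x i * S) <= (size s)%:R * x i ^+ 2 + Q.
  rewrite /S /Q !mulr_sumr; elim: s {IHs S Q Q0} => [|j s IHs] /=.
    by rewrite !big_nil mul0r addr0.
  rewrite !big_cons -natr1 mulrDl mul1r.
  have := sqr_ge0 (x i - x j); lra.
rewrite -natr1; lra.
Qed.

(* Bounded finite partial sums, the working form of the summability. *)
Definition kbounded (k : nat) f := exists M : R, forall s : seq mindex, uniq s ->
  \sum_(a <- s) Normc.normc (f a) ^+ 2 * nweight a ^- k <= M.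

Lemma kterm_ge0 k f a : 0 <= Normc.normc (f a) ^+ 2 * nweight a ^- k.
Proof. by rewrite mulr_ge0 ?sqr_ge0// invr_ge0 exprn_ge0// ltW ?nweight_gt0. Qed.

Lemma kbounded_le k k' f : (k <= k')%N -> kbounded k f -> kbounded k' f.
Proof.
move=> kk' [M fM]; exists M => s us; apply: le_trans (fM s us).
apply: ler_sum => a _; rewrite ler_wpM2l ?sqr_ge0// lef_pV2 ?posrE ?exprn_gt0 ?nweight_gt0//.
by rewrite ler_weXn2l ?nweight_ge1.
Qed.

Lemma in_kondratievP f : in_kondratiev f <-> exists2 k, (0 < k)%N & kbounded k f.
Proof.
split=> [[k [k0 fk]]|[k k0 [M fM]]]; exists k => //; last first.
  split=> //; apply: (@le_lt_trans _ _ M%:E); last exact: ltry.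
  apply: ge_ereal_sup => _ [A [finA _]] <-.
  rewrite fsbig_finite// sumEFin lee_fin.
  under eq_bigr do rewrite weightN; exact/fM/fset_uniq.
move: fk; set E := esum _ _ => fk.
have E0 : (0 <= E)%E.
  by apply: esum_ge0 => a _; rewrite lee_fin weightN kterm_ge0.
have Efin : E \is a fin_num by rewrite ge0_fin_numE.
exists (fine E) => s us; rewrite -lee_fin fineK//.
apply: esum_ge; exists [set` s]; first by split => //; exact: finite_seq.
rewrite -fsbig_seq// sumEFin lee_fin.
by under [leRHS]eq_bigr do rewrite weightN.
Qed.

Lemma kondratiev_const c : in_kondratiev (const_series c).
Proof.
apply/in_kondratievP; exists 1%N => //.
exists (Normc.normc c ^+ 2 * nweight 0 ^- 1) => s us.
have [s0|s0] := boolP (0 \in s); last first.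
  rewrite big_seq big1 => [|a /[dup] sa]; first exact: kterm_ge0 1%N (fun=> c) 0.
  by rewrite /const_series; case: eqP s0 sa => [->/negP //|]; rewrite Normc.normc0 expr0n mul0r.
rewrite (bigD1_seq 0)//= {1}/const_series eqxx big1 ?addr0// => a /negPf a0.
by rewrite /const_series a0 Normc.normc0 expr0n mul0r.
Qed.

Lemma kondratiev_opp f : in_kondratiev f -> in_kondratiev (- f).
Proof.
move=> /in_kondratievP[k k0 [M fM]]; apply/in_kondratievP; exists k => //.
exists M => s us; apply: le_trans (fM s us).
by apply: ler_sum => a _; rewrite [(- f) a]/(- f a) normcN.
Qed.

Lemma normc_ge0 (z : R[i]) : 0 <= Normc.normc z.
Proof. by case: z => x y; rewrite /= sqrtr_ge0. Qed.

Lemma kondratiev_add f g :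
  in_kondratiev f -> in_kondratiev g -> in_kondratiev (f + g).
Proof.
move=> /in_kondratievP[k k0 fk] /in_kondratievP[l l0 gl].
apply/in_kondratievP; exists (maxn k l); first by rewrite leq_max k0.
have [M fM] := kbounded_le (leq_maxl k l) fk.
have [N gN] := kbounded_le (leq_maxr k l) gl.
exists (2 * M + 2 * N) => s us.
apply: le_trans
  (lerD (ler_wpM2l (ler0n _ 2) (fM s us)) (ler_wpM2l (ler0n _ 2) (gN s us))).
rewrite !mulr_sumr -big_split; apply: ler_sum => a _ /=.
rewrite !mulrA -mulrDl ler_wpM2r ?invr_ge0 ?exprn_ge0 ?(ltW (nweight_gt0 _))//.
rewrite [(f + g) a]/(f a + g a).
set x := Normc.normc (f a); set y := Normc.normc (g a).
apply: (@le_trans _ _ ((x + y) ^+ 2)); last by have := sqr_ge0 (x - y); lra.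
by rewrite ler_sqr ?nnegrE ?addr_ge0 ?normc_ge0// le_normcD.
Qed.

Lemma normc_sum_le (I : Type) (s : seq I) (x : I -> R[i]) :
  Normc.normc (\sum_(i <- s) x i) <= \sum_(i <- s) Normc.normc (x i).
Proof.
elim: s => [|i s IHs]; first by rewrite !big_nil Normc.normc0.
by rewrite !big_cons (le_trans (le_normcD _ _))// lerD2l.
Qed.

Lemma cauchy_prod_term_le k f g a :
  Normc.normc (cauchy_prod f g a) ^+ 2 * nweight a ^- k.+1 <=
  \sum_(p <- split_seq a) (Normc.normc (f p.1) ^+ 2 * nweight p.1 ^- k) *
    (Normc.normc (g p.2) ^+ 2 * nweight p.2 ^- k).
Proof.
have w0 := nweight_gt0 a.
have -> : \sum_(p <- split_seq a) (Normc.normc (f p.1) ^+ 2 * nweight p.1 ^- k) *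
    (Normc.normc (g p.2) ^+ 2 * nweight p.2 ^- k) =
  (\sum_(p <- split_seq a) Normc.normc (f p.1 * g p.2) ^+ 2) * nweight a ^- k.
  rewrite mulr_suml big_seq [RHS]big_seq; apply: eq_bigr => p.
  rewrite split_seqP => /eqP <-.
  by rewrite nweightD Normc.normcM !exprMn invfM mulrACA.
rewrite [nweight a ^+ k.+1]exprS invfM mulrA.
rewrite ler_wpM2r ?invr_ge0 ?exprn_ge0 ?(ltW w0)//.
rewrite ler_pdivrMr// [leRHS]mulrC.
apply: (@le_trans _ _
  ((\sum_(p <- split_seq a) Normc.normc (f p.1 * g p.2)) ^+ 2)).
  rewrite cauchy_prodE ler_sqr ?nnegrE ?normc_sum_le ?normc_ge0//.
  by apply: sumr_ge0 => p _; exact: normc_ge0.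
apply: le_trans (sqr_sum_le _ _) _; rewrite ler_wpM2r ?size_splits_le//.
by apply: sumr_ge0 => p _; exact: sqr_ge0.
Qed.

Lemma kondratiev_mul f g :
  in_kondratiev f -> in_kondratiev g -> in_kondratiev (cauchy_prod f g).
Proof.
move=> /in_kondratievP[k k0 fk] /in_kondratievP[l l0 gl].
apply/in_kondratievP; exists (maxn k l).+1 => //.
have [M fM] := kbounded_le (leq_maxl k l) fk.
have [N gN] := kbounded_le (leq_maxr k l) gl.
move: {k k0 fk l l0 gl} (maxn k l) fM gN => k fM gN.
pose X b := Normc.normc (f b) ^+ 2 * nweight b ^- k.
pose Y b := Normc.normc (g b) ^+ 2 * nweight b ^- k.
have X0 b : 0 <= X b by exact: kterm_ge0.
have Y0 b : 0 <= Y b by exact: kterm_ge0.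
exists (M * N) => s us.
apply: le_trans (ler_sum _ (fun a _ => cauchy_prod_term_le k f g a)) _.
pose S := [seq p | a <- s, p <- split_seq a].
rewrite [leLHS](_ : _ = \sum_(p <- S) X p.1 * Y p.2); last first.
  by rewrite big_allpairs_dep.
have uS : uniq S.
  apply: allpairs_uniq_dep => // [a _|]; first exact: split_seq_uniq.
  move=> x y /allpairsPdep[a [p [_ + ->]]]; rewrite split_seqP => /eqP <-.
  by move=> /allpairsPdep[b [q [_ + ->]]] /=; rewrite split_seqP => /eqP <- ->.
pose B := undup (map fst S); pose G := undup (map snd S).
pose P := [seq (b, c) | b <- B, c <- G].
have uP : uniq P by apply: allpairs_uniq; rewrite ?undup_uniq// => -[? ?] [? ?].
have -> : \sum_(p <- S) X p.1 * Y p.2 = \sum_(p <- P | p \in S) X p.1 * Y p.2.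
  rewrite -[RHS]big_filter; apply: perm_big; apply: uniq_perm; rewrite ?filter_uniq//.
  move=> p; rewrite mem_filter andb_idr// => pS; apply/allpairsP; exists p.
  by rewrite !mem_undup !map_f//; split => //; case: p {pS}.
apply: (@le_trans _ _ (\sum_(p <- P) X p.1 * Y p.2)).
  rewrite big_mkcond; apply: ler_sum => p _.
  by case: ifP => // _; rewrite mulr_ge0.
rewrite big_allpairs /=.
under eq_bigr do rewrite -mulr_sumr.
rewrite -mulr_suml ler_pM ?sumr_ge0//; first exact/fM/undup_uniq.
exact/gN/undup_uniq.
Qed.

End Kondratiev.

(* The ring of Hermite transforms of the Kondratiev space S_(-1), over the
   complex numbers R[i]; [R : realType] is the field of real numbers. *)
Record kondratiev (R : realType) := Kondratiev {
  kcoef :> mindex -> R[i];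
  _ : `[< in_kondratiev kcoef >]
}.

HB.instance Definition _ (R : realType) := [isSub for @kcoef R].
HB.instance Definition _ (R : realType) := [Choice of kondratiev R by <:].

Section KondratievRing.
Context {R : realType}.
Implicit Types F G H : kondratiev R.

Lemma kcoefP F : in_kondratiev F.
Proof. by case: F => f /= /asboolP. Qed.

Lemma kcoef_inj F G : (forall a, F a = G a) -> F = G.
Proof. by move=> FG; apply/val_inj/funext. Qed.

Definition kzero : kondratiev R :=
  Kondratiev (asboolT (kondratiev_const 0)).
Definition kone : kondratiev R :=
  Kondratiev (asboolT (kondratiev_const 1)).
Definition kopp F : kondratiev R :=
  Kondratiev (asboolT (kondratiev_opp (kcoefP F))).
Definition kadd F G : kondratiev R :=
  Kondratiev (asboolT (kondratiev_add (kcoefP F) (kcoefP G))).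
Definition kmul F G : kondratiev R :=
  Kondratiev (asboolT (kondratiev_mul (kcoefP F) (kcoefP G))).

Lemma kaddA : associative kadd.
Proof. by move=> F G H; apply: kcoef_inj => a; exact: addrA. Qed.

Lemma kaddC : commutative kadd.
Proof. by move=> F G; apply: kcoef_inj => a; exact: addrC. Qed.

Lemma kadd0 : left_id kzero kadd.
Proof.
move=> F; apply: kcoef_inj => a.
suff -> : kadd kzero F a = 0 + F a by rewrite add0r.
by congr (_ + _); rewrite /= /const_series if_same.
Qed.

Lemma kaddN : left_inverse kzero kopp kadd.
Proof.
move=> F; apply: kcoef_inj => a.
by rewrite /= /const_series if_same; exact: addNr.
Qed.

HB.instance Definition _ :=
  GRing.isZmodule.Build (kondratiev R) kaddA kaddC kadd0 kaddN.

Lemma kmulA : associative kmul.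
Proof. by move=> F G H; apply: val_inj; exact: cauchy_prodA. Qed.

Lemma kmulC : commutative kmul.
Proof. by move=> F G; apply: val_inj; exact: cauchy_prodC. Qed.

Lemma kmul1 : left_id kone kmul.
Proof. by move=> F; apply: val_inj; exact: cauchy_prod1. Qed.

Lemma kmulDl : left_distributive kmul kadd.
Proof. by move=> F G H; apply: val_inj; exact: cauchy_prodDl. Qed.

Lemma kone_neq0 : kone != 0.
Proof.
apply/eqP => /(congr1 (fun F : kondratiev R => F 0)) /=.
by rewrite /const_series eqxx => /eqP; rewrite oner_eq0.
Qed.

HB.instance Definition _ := GRing.Zmodule_isComNzRing.Build (kondratiev R)
  kmulA kmulC kmul1 kmulDl kone_neq0.

End KondratievRing.

Definition const_coef (R : realType) (F : kondratiev R) : R[i] := F 0.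

(* The map f |-> (C f, C A f, C A^2 f, ...) from R^N to (R^p)^nat. *)
Definition observability_map (R : comNzRingType) (p N : nat)
    (C : 'M[R]_(p, N)) (A : 'M[R]_N) (f : 'cV[R]_N) : nat -> 'cV[R]_p :=
  fun n => C *m A ^+ n *m f.

Definition observable_pair (R : comNzRingType) (p N : nat)
    (C : 'M[R]_(p, N)) (A : 'M[R]_N) : Prop :=
  injective (observability_map C A).

(* State-space data of the realization D + zeta C (I_N - zeta A)^-1 B. *)
Record realization (R : comNzRingType) (p q N : nat) := Realization {
  rA : 'M[R]_N;
  rB : 'M[R]_(N, q);
  rC : 'M[R]_(p, N);
  rD : 'M[R]_(p, q)
}.

Definition observable (R : comNzRingType) (p q N : nat)
    (S : realization R p q N) : Prop :=
  observable_pair (rC S) (rA S).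

(* Main.v *)
Require Import Defs.
From HB Require Import structures.
From mathcomp Require Import all_boot all_order all_algebra finmap complex.
From mathcomp Require Import boolp reals.
Import GRing.Theory.
Local Open Scope complex_scope.
Local Open Scope ring_scope.

(** Let [h] be a vector over the ring with [C A^n h = 0] for every [n], and
    suppose that the coefficients of [h] vanish in all total degrees below that
    of a multi-index [a].  In the Cauchy product [M h], the coefficient at [a]
    is a sum over the splittings [a = b + c] of [M_b h_c]; unless [b = 0] the
    degree of [c] is smaller than that of [a], so only [M_0 h_a] survives
    ([coef_mulmx_lowest]).  For [M = C A^n] this reads
    [C(0) A(0)^n h_a = 0] for every [n], whence [h_a = 0] by observability of
    the constant coefficients.  Strong induction on the degree gives [h = 0]. *)

Definition mdeg (a : mindex) : nat := (\sum_(j <- finsupp a) a j)%N.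

Lemma mdegE (K : {fset nat}) (a : mindex) :
  fsubset (finsupp a) K -> mdeg a = (\sum_(j <- K) a j)%N.
Proof. by move=> aK; apply: big_fset_incl => // j _ /fsfun_dflt. Qed.

Lemma mdegD (a b : mindex) : mdeg (a + b) = (mdeg a + mdeg b)%N.
Proof.
pose K := fsetU (finsupp a) (finsupp b).
rewrite (@mdegE K a) ?fsubsetUl// (@mdegE K b) ?fsubsetUr//.
rewrite (@mdegE K (a + b)) ?finsupp_sub// -big_split.
by apply: eq_bigr => j _; rewrite mindexD.
Qed.

Lemma mdeg0 : mdeg 0 = 0%N.
Proof. by rewrite /mdeg big1// => j _; rewrite mindex0. Qed.

Lemma mdeg_gt0 (a : mindex) : a != 0 -> (0 < mdeg a)%N.
Proof.
apply: contraNT; rewrite -eqn0Ngt => /eqP a0; apply/eqP/mindexP => j.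
have [ja|/fsfun_dflt ->] := boolP (j \in finsupp a); last by rewrite mindex0.
move: a0; rewrite /mdeg (big_fsetD1 j)//= mindex0 => /eqP.
by rewrite addn_eq0 => /andP[/eqP].
Qed.

Section Coefficients.
Context {R : realType}.
Implicit Types (F G : kondratiev R) (a b : mindex).

Lemma kcoef0 a : (0 : kondratiev R) a = 0.
Proof. by rewrite /= /const_series if_same. Qed.

Lemma kcoef_sum (I : Type) (s : seq I) (F : I -> kondratiev R) a :
  (\sum_(i <- s) F i) a = \sum_(i <- s) F i a.
Proof. exact: (big_morph (fun G : kondratiev R => G a) _ (kcoef0 a)). Qed.

(** Every splitting of [a] other than [0 + a] puts a multi-index of smaller
    degree on [G], where its coefficient vanishes. *)
Lemma kcoef_mul_lowest F G a :
  (forall b, (mdeg b < mdeg a)%N -> G b = 0) -> (F * G) a = F 0 * G a.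
Proof.
move=> G0; rewrite [LHS]cauchy_prodE.
rewrite (bigD1_seq (0, a)) ?split_seq_uniq ?split_seqP /= ?add0r//.
rewrite big_seq_cond big1 ?addr0// => -[b c] /=.
rewrite split_seqP /= => /andP[/eqP bca bc0].
have b0 : b != 0.
  by apply: contra bc0 => /eqP b0; rewrite -bca b0 add0r.
by rewrite G0 ?mulr0// -bca mdegD -addn1 addnC leq_add2r mdeg_gt0.
Qed.

Definition coef_mx {m n : nat} a (M : 'M[kondratiev R]_(m, n)) : 'M[R[i]]_(m, n) :=
  map_mx (fun F : kondratiev R => F a) M.

Lemma coef_mulmx_lowest (m n r : nat) (M : 'M[kondratiev R]_(m, n))
    (H : 'M[kondratiev R]_(n, r)) a :
  (forall b, (mdeg b < mdeg a)%N -> coef_mx b H = 0) ->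
  coef_mx a (M *m H) = coef_mx 0 M *m coef_mx a H.
Proof.
move=> H0; apply/matrixP => i j; rewrite !mxE kcoef_sum.
apply: eq_bigr => k _; rewrite !mxE kcoef_mul_lowest// => b /H0.
by move=> /matrixP/(_ k j); rewrite !mxE.
Qed.

(** Degree [0] is always lowest, so taking constant coefficients is
    multiplicative. *)
Lemma coef0_mulmx (m n r : nat) (M : 'M[kondratiev R]_(m, n))
    (H : 'M[kondratiev R]_(n, r)) :
  coef_mx 0 (M *m H) = coef_mx 0 M *m coef_mx 0 H.
Proof. by apply: coef_mulmx_lowest => b; rewrite mdeg0. Qed.

Lemma coef0_expmx (n k : nat) (M : 'M[kondratiev R]_n) :
  coef_mx 0 (M ^+ k) = coef_mx 0 M ^+ k.
Proof.
elim: k => [|k IHk]; last by rewrite !exprS -IHk; exact: coef0_mulmx.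
apply/matrixP => i j; rewrite !mxE.
by case: (i == j); rewrite ?kcoef0//= /const_series eqxx.
Qed.

Lemma observable_pair_coef0 (p N : nat) (C : 'M[kondratiev R]_(p, N))
    (A : 'M[kondratiev R]_N) :
  observable_pair (coef_mx 0 C) (coef_mx 0 A) -> observable_pair C A.
Proof.
move=> obs0 f g fg; apply/eqP; rewrite -subr_eq0; apply/eqP.
set h := f - g.
have CAh k : C *m A ^+ k *m h = 0.
  by move/(congr1 (@^~ k)): fg; rewrite mulmxBr /observability_map => ->; rewrite subrr.
suff h0 d a : (mdeg a < d)%N -> coef_mx a h = 0.
  apply/matrixP => i j; apply: kcoef_inj => a.
  by have /matrixP/(_ i j) := h0 _ a (ltnSn _); rewrite !mxE kcoef0.
(* Below degree [mdeg a] the induction hypothesis kills [h], so the coefficient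
   at [a] of [C A^k h] is its lowest one. *)
elim: d a => // d IHd a; rewrite ltnS => ad; apply: obs0; apply/funext => k.
rewrite /observability_map mulmx0 -coef0_expmx -coef0_mulmx -coef_mulmx_lowest.
  by rewrite CAh; apply/matrixP => i j; rewrite !mxE kcoef0.
by move=> b ba; apply: IHd; apply: leq_trans ad.
Qed.

End Coefficients.

Theorem theorem5p3 (R : realType) (p q N : nat)
    (A : 'M[kondratiev R]_N) (B : 'M[kondratiev R]_(N, q))
    (C : 'M[kondratiev R]_(p, N)) (D : 'M[kondratiev R]_(p, q)) :
  observable (Realization
    (map_mx (@const_coef R) A) (map_mx (@const_coef R) B)
    (map_mx (@const_coef R) C) (map_mx (@const_coef R) D)) ->
  observable (Realization A B C D).
Proof. exact: observable_pair_coef0. Qed.
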